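(* Let $u$ and $v$ be isolating nodes in a network model $\mathcal{N}$, where the layer index of $u$ is smaller than that of $v$. For any arc $a$ of $\mathcal{N}[u,v]$, if $\mathrm{PF}(\mathcal{N}[u,v]) = \mathrm{PF}(\mathcal{N}[u,v] - a)$, then $\mathrm{PF}(\mathcal{N}) = \mathrm{PF}(\mathcal{N} - a)$. That is, if the removal of arc $a$ is a validity-preserving operation in $\mathcal{N}[u,v]$, then it is also a validity-preserving operation in $\mathcal{N}$.
   Context: Dominance: for $y, y' \in \mathbb{R}^K$, $y$ dominates $y'$ (written $y \succ y'$) if $y_k \ge y'_k$ for all $k \in \{1,\dots,K\}$ and $y_{k} > y'_{k}$ for at least one $k$. For a set $S \subseteq \mathbb{R}^K$, $\mathrm{ND}(S) := \{ y \in S : \nexists\, y' \in S \text{ with } y' \succ y\}$. Network model: a (finite) layered acyclic multi-digraph $\mathcal{N} = (\mathcal{L}, \mathcal{A})$ (parallel arcs allowed). The node set $\mathcal{L}$ is partitioned into $n+1$ non-empty layers $\mathcal{L}_1, \dots, \mathcal{L}_{n+1}$, with $\mathcal{L}_1 = \{\mathbf{r}\}$ (root) and $\mathcal{L}_{n+1} = \{\mathbf{t}\}$ (terminal). Each arc $a$ is directed from its arc-root $r(a) \in \mathcal{L}_j$ to its arc-terminal $t(a) \in \mathcal{L}_{j+1}$ for some $j \in \{1,\dots,n\}$, and has a weight vector $w(a) \in \mathbb{R}^K$. Paths are directed and specified by their sequences of arcs; the weight $w(p)$ of a path $p$ is the sum of the weights of its arcs. $\mathcal{P}$ is the set of paths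 from $\mathbf{r}$ to $\mathbf{t}$. The Pareto frontier of $\mathcal{N}$ is $\mathrm{PF}(\mathcal{N}) := \mathrm{ND}(\{ w(p) : p \in \mathcal{P}\})$. A transformation of $\mathcal{N}$ into $\mathcal{N}'$ is a validity-preserving operation (VPO) if $\mathrm{PF}(\mathcal{N}) = \mathrm{PF}(\mathcal{N}')$. $\mathcal{N} - a$ denotes the network resulting from removing the arc $a$ from $\mathcal{N}$. For nodes $u, v$ with the layer index of $u$ smaller than that of $v$, $\mathcal{N}[u,v]$ is the network model (with root $u$ and terminal $v$) containing only the nodes and arcs of $\mathcal{N}$ that lie on some path starting at $u$ and ending at $v$, with the same arc weights; $\mathrm{PF}(\mathcal{N}[u,v])$ and $\mathrm{PF}(\mathcal{N}[u,v]-a)$ are defined via paths from $u$ to $v$ in $\mathcal{N}[u,v]$ and $\mathcal{N}[u,v]-a$, respectively. Isolating: a pair of nodes $u, v$ is isolating in $\mathcal{N}$ when, for every arc $a$ of $\mathcal{N}$ that is not an arc of $\mathcal{N}[u,v]$: (i) if $t(a)$ is a node of $\mathcal{N}[u,v]$, then $t(a) = u$; and (ii) if $r(a)$ is a node of $\mathcal{N}[u,v]$, then $r(a) = v$. *)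

(* Defs.v *)
(* MathComp, with MathComp-Analysis sets and reals. *)
From mathcomp Require Import all_boot all_order all_algebra.
From mathcomp Require Import boolp classical_sets cardinality reals.

Set Implicit Arguments.
Unset Strict Implicit.
Unset Printing Implicit Defensive.

Import Order.TTheory GRing.Theory Num.Theory.

Local Open Scope classical_set_scope.
Local Open Scope ring_scope.

Section Dominance.
Variables (R : realType) (K : nat).

Definition dominates (y y' : 'rV[R]_K) : Prop :=
  (forall k, y' 0 k <= y 0 k) /\ (exists k, y' 0 k < y 0 k).

Definition ND (S : set 'rV[R]_K) : set 'rV[R]_K :=
  [set y | S y /\ ~ exists y', S y' /\ dominates y' y].

End Dominance.

(* A network lives on carrier types X (of nodes) and A (of arcs), of which only
   the elements of [nodes] and [arcs] belong to it, so that a subnetwork has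
   the same carriers. Arcs are named, hence parallel arcs are allowed.
   There are depth + 1 layers, numbered from 1: the j-th one consists of the
   nodes x such that layer x = j. The values of [layer], [src], [tgt] and
   [weight] outside of [nodes] and [arcs] are irrelevant. *)
Record network (R : realType) (K : nat) (X A : choiceType) := Network {
  nodes : set X;
  arcs : set A;
  depth : nat;
  layer : X -> nat;
  root : X;
  terminal : X;
  src : A -> X;
  tgt : A -> X;
  weight : A -> 'rV[R]_K }.

Section Network.
Variables (R : realType) (K : nat) (X A : choiceType).
Implicit Type N : network R K X A.

Record network_model N : Prop := NetworkModel {
  finite_nodes : finite_set (nodes N);
  finite_arcs : finite_set (arcs N);
  layer_range : forall x, nodes N x -> (1 <= layer N x <= (depth N).+1)%N;
  layer_nonempty : forall j, (1 <= j <= (depth N).+1)%N ->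
    exists2 x, nodes N x & layer N x = j;
  first_layer : [set x | nodes N x /\ layer N x = 1%N] = [set root N];
  last_layer : [set x | nodes N x /\ layer N x = (depth N).+1] = [set terminal N];
  arc_src : forall a, arcs N a -> nodes N (src N a);
  arc_tgt : forall a, arcs N a -> nodes N (tgt N a);
  arc_layer : forall a, arcs N a -> layer N (tgt N a) = (layer N (src N a)).+1 }.

Fixpoint is_path N (x : X) (p : seq A) (y : X) : Prop :=
  if p is a :: p' then [/\ arcs N a, src N a = x & is_path N (tgt N a) p' y]
  else nodes N x /\ x = y.

Definition path_nodes N (x : X) (p : seq A) : seq X := x :: map (tgt N) p.

Definition path_weight N (p : seq A) : 'rV[R]_K := \sum_(a <- p) weight N a.

Definition PF N : set 'rV[R]_K :=
  ND [set path_weight N p | p in [set p | is_path N (root N) p (terminal N)]].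

Definition remove_arc N (a : A) : network R K X A :=
  {| nodes := nodes N;
     arcs := arcs N `\ a;
     depth := depth N;
     layer := layer N;
     root := root N;
     terminal := terminal N;
     src := src N;
     tgt := tgt N;
     weight := weight N |}.

(* The layers of N strictly before that of u are dropped, and the remaining
   ones renumbered so that u is in layer 1. *)
Definition subnetwork N (u v : X) : network R K X A :=
  {| nodes := [set x | exists2 p, is_path N u p v & x \in path_nodes N u p];
     arcs := [set a | exists2 p, is_path N u p v & a \in p];
     depth := (layer N v - layer N u)%N;
     layer := fun x => (layer N x - layer N u).+1;
     root := u;
     terminal := v;
     src := src N;
     tgt := tgt N;
     weight := weight N |}.

Definition isolating N (u v : X) : Prop :=
  forall a, arcs N a -> ~ arcs (subnetwork N u v) a ->
    (nodes (subnetwork N u v) (tgt N a) -> tgt N a = u) /\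
    (nodes (subnetwork N u v) (src N a) -> src N a = v).

Lemma remove_arc_model N a : network_model N -> network_model (remove_arc N a).
Proof.
case=> fN fA lr ln fl ll As At Al; split=> //=.
- exact: finite_setD.
- by move=> b [/As].
- by move=> b [/At].
- by move=> b [/Al].
Qed.

Lemma is_path_last N x p y : is_path N x p y -> y \in path_nodes N x p.
Proof.
elim: p x => [|a p IH] x /=; first by case=> _ ->; rewrite mem_head.
by case=> _ _ /IH; rewrite !inE => H; rewrite H orbT.
Qed.

Lemma is_path_arc N x p y a : is_path N x p y -> a \in p ->
  arcs N a /\ src N a \in path_nodes N x p.
Proof.
elim: p x => [|b p IH] x //= [Ab <- /IH H].
rewrite !inE => /orP[/eqP ->|/H[Aa sa]]; first by rewrite eqxx.
by split=> //; move: sa; rewrite !inE => ->; rewrite orbT.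
Qed.

Lemma is_path_nodes N x p y : network_model N -> is_path N x p y ->
  [/\ nodes N x, nodes N y & forall z, z \in path_nodes N x p -> nodes N z].
Proof.
move=> mN; elim: p x => [|a p IH] x /=.
  by case=> Nx <-; split=> // z; rewrite inE => /eqP ->.
case=> Aa <- /IH [Nt Ny Nz].
have Ns := arc_src mN Aa; split=> // z; rewrite inE => /orP[/eqP->|] //.
exact: Nz.
Qed.

Lemma is_path_layer N x p y : network_model N -> is_path N x p y ->
  layer N y = (layer N x + size p)%N.
Proof.
move=> mN; elim: p x => [|a p IH] x /=; first by case=> _ ->; rewrite addn0.
by case=> Aa <- /IH ->; rewrite (arc_layer mN Aa) addnS addSn.
Qed.

Lemma is_path_cat N x p q y : network_model N ->
  is_path N x (p ++ q) y <-> exists2 z, is_path N x p z & is_path N z q y.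
Proof.
move=> mN; elim: p x => [|a p IH] x /=.
  split=> [H|[z [_ ->]]] //; exists x => //; split=> //.
  by have [] := is_path_nodes mN H.
split=> [[Aa sa /IH[z H1 H2]]|[z [Aa sa H1] H2]]; first by exists z.
by split=> //; apply/IH; exists z.
Qed.

Lemma is_path_split N x p y z : network_model N -> is_path N x p y ->
  z \in path_nodes N x p ->
  exists p1 p2, [/\ p = p1 ++ p2, is_path N x p1 z & is_path N z p2 y].
Proof.
move=> mN; elim: p x => [|a p IH] x /= H.
  by rewrite inE => /eqP ->; exists [::], [::]; case: H => ? ?; split.
have [Nx _ _] := is_path_nodes (p := a :: p) mN H.
rewrite inE => /orP[/eqP ->|]; first by exists [::], (a :: p); split.
case: H => Aa sa /IH{}IH /IH [p1 [p2 [-> H1 H2]]].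
by exists (a :: p1), p2; split.
Qed.

(* If no path of N joins u to v then N[u,v] is empty, hence not a model. *)
Lemma subnetwork_model N u v : network_model N ->
  (exists p, is_path N u p v) -> network_model (subnetwork N u v).
Proof.
move=> mN [p0 Hp0].
have sub z : nodes (subnetwork N u v) z -> nodes N z.
  by case=> p Hp; have [_ _] := is_path_nodes mN Hp; apply.
have luv := is_path_layer mN Hp0.
have lay z : nodes (subnetwork N u v) z ->
    exists i j, [/\ layer N z = (layer N u + i)%N,
      layer N v = (layer N u + i + j)%N,
      i = 0%N -> z = u & j = 0%N -> z = v].
  case=> p Hp /(is_path_split mN Hp)[p1 [p2 [_ H1 H2]]].
  exists (size p1), (size p2).
  rewrite (is_path_layer mN H2) (is_path_layer mN H1); split=> //.
    by move/size0nil => E; move: H1; rewrite E => -[].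
  by move/size0nil => E; move: H2; rewrite E => -[].
split=> /=.
- by apply: sub_finite_set (finite_nodes mN) => z; apply: sub.
- by apply: sub_finite_set (finite_arcs mN) => a /= [p /is_path_arc H /H[]].
- move=> x /lay[i [j [-> -> _ _]]].
  by rewrite -addnA !addKn ltnS leq_addr.
- case=> [|j] //; rewrite luv addKn /= ltnS => jp.
  have H : is_path N u (take j p0 ++ drop j p0) v by rewrite cat_take_drop.
  have [z H1 H2] := (is_path_cat _ _ _ _ mN).1 H.
  exists z; last by rewrite (is_path_layer mN H1) addKn size_takel.
  exists p0 => //; rewrite -(cat_take_drop j p0) /path_nodes map_cat -cat_cons.
  by rewrite mem_cat; apply/orP; left; apply: is_path_last H1.
- apply/seteqP; split=> x /=.
    by case=> /lay[i [j [-> _ H _]]]; rewrite addKn => -[/H].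
  by move=> ->; split; [exists p0; rewrite ?mem_head | rewrite subnn].
- apply/seteqP; split=> x /=.
    case=> /lay[i [j [-> -> _ H]]]; rewrite -addnA !addKn => -[/esym/eqP].
    by rewrite -{2}[i]addn0 eqn_add2l => /eqP /H.
  by move=> ->; split=> //; exists p0 => //; apply: is_path_last Hp0.
- by move=> a [p Hp ap]; exists p => //; have [] := is_path_arc Hp ap.
- by move=> a [p Hp ap]; exists p => //; rewrite inE map_f ?orbT.
- move=> a [p Hp ap]; have [Aa sa] := is_path_arc Hp ap.
  have [|i [j [E _ _ _]]] := lay (src N a); first by exists p.
  by rewrite (arc_layer mN Aa) E -addnS !addKn.
Qed.

End Network.

(* Main.v *)
(* A root-terminal path p through a must pass through u and v, because arcs
   enter N[u,v] only at u and leave it only at v. Its segment from u to v is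
   weakly dominated by a Pareto optimal u-v path q, since there are finitely
   many of them, and by hypothesis q can be chosen to avoid a. Replacing the
   segment by q yields a path of N - a that weakly dominates p. *)
Require Import Defs.
From mathcomp Require Import all_boot all_order all_algebra.
From mathcomp Require Import boolp classical_sets cardinality reals.

Set Implicit Arguments.
Unset Strict Implicit.
Unset Printing Implicit Defensive.

Import Order.TTheory GRing.Theory Num.Theory.

Local Open Scope classical_set_scope.
Local Open Scope ring_scope.

(** * Maxima over finite sets and finiteness of sets of sequences *)

Lemma seq_argmax (T : eqType) (R : realDomainType) (f : T -> R) (s : seq T) x :
  x \in s -> exists2 z, z \in s & forall z', z' \in s -> f z' <= f z.
Proof.
elim: s x => // y [|y' s] IH x xs.
  by exists y; rewrite ?mem_head // => z; rewrite inE => /eqP ->.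
have [z zs zmax] := IH y' (mem_head _ _).
have [yz|/ltW zy] := leP (f y) (f z).
  exists z; first by rewrite inE zs orbT.
  by move=> z'; rewrite inE => /orP[/eqP ->|/zmax].
exists y; first exact: mem_head.
by move=> z'; rewrite inE => /orP[/eqP ->|/zmax /le_trans]; last exact.
Qed.

Lemma finite_set_argmax (T : choiceType) (R : realDomainType) (f : T -> R)
    (S : set T) x :
  finite_set S -> S x -> exists2 z, S z & forall z', S z' -> f z' <= f z.
Proof.
by move=> /finite_seqP[s ->] /(seq_argmax f)[z zs zmax]; exists z.
Qed.

Lemma finite_set_seqs (T : choiceType) (B : set T) m : finite_set B ->
  finite_set [set s : seq T | size s = m /\ {in s, forall x, B x}].
Proof.
move=> fB; elim: m => [|m IH].
  apply: sub_finite_set (finite_set1 [::]) => s [/size0nil -> _] //.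
have := finite_image (fun xs : T * seq T => xs.1 :: xs.2) (finite_setX fB IH).
apply: sub_finite_set => -[|x s] [//= [sm] sB].
exists (x, s) => //; split=> /=; first by apply: sB; rewrite mem_head.
by split=> // y ys; apply: sB; rewrite inE ys orbT.
Qed.

(** * Weak dominance and nondominated sets *)

Section WeakDominance.
Variables (R : realType) (K : nat).
Implicit Types (y z : 'rV[R]_K) (S : set 'rV[R]_K).

Definition weakly_dominates y y' : Prop := forall k, y' 0 k <= y 0 k.

Lemma weakly_dominates_trans y1 y2 y3 : weakly_dominates y1 y2 ->
  weakly_dominates y2 y3 -> weakly_dominates y1 y3.
Proof. by move=> y12 y23 k; apply: le_trans (y23 k) (y12 k). Qed.

Lemma weakly_dominates_eq y y' :
  weakly_dominates y y' -> ~ dominates y y' -> y = y'.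
Proof.
move=> yy' ndom; apply/rowP => k; apply/eqP; rewrite eq_le yy' andbT.
by rewrite leNgt; apply/negP => lt_k; apply: ndom; split=> //; exists k.
Qed.

Lemma weakly_dominates_dominates y1 y2 y3 :
  weakly_dominates y1 y2 -> dominates y2 y3 -> dominates y1 y3.
Proof.
move=> y12 [y23 [k lt_k]]; split; first exact: weakly_dominates_trans y12 y23.
by exists k; apply: lt_le_trans (y12 k).
Qed.

(** A nondominated [y] of [S] can only be weakly dominated by itself, so it lies in [S'].
    Conversely, a point of [S] dominating [y] yields one of [S'] that still dominates [y]. *)
Lemma ND_cofinal_subset S S' : S' `<=` S ->
  (forall y, S y -> exists2 y', S' y' & weakly_dominates y' y) -> ND S = ND S'.
Proof.
move=> S'S cof; apply/seteqP; split=> y [Sy nd].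
  have [y' S'y' y'y] := cof _ Sy.
  have E : y' = y.
    apply: weakly_dominates_eq => // dom; apply: nd.
    by exists y'; split=> //; exact: S'S.
  split; first by rewrite -E.
  by case=> z [/S'S Sz dom]; apply: nd; exists z.
split; first exact: S'S.
case=> z [/cof[z' S'z' z'z] dom]; apply: nd; exists z'; split=> //.
exact: weakly_dominates_dominates dom.
Qed.

(** Among the points weakly dominating [y], one with maximal coordinate sum is nondominated, as
    dominance strictly increases that sum. *)
Lemma finite_ND_cofinal S y : finite_set S -> S y ->
  exists2 z, ND S z & weakly_dominates z y.
Proof.
move=> fS Sy; pose above := [set z | S z /\ weakly_dominates z y].
have fabove : finite_set above by apply: sub_finite_set fS => z [].
have y_above : above y by split.
have [z [Sz zy] zmax] :=
  finite_set_argmax (fun z : 'rV[R]_K => \sum_k z 0 k) fabove y_above.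
exists z => //; split=> // -[z' [Sz' dom]].
have [z'z [k lt_k]] := dom.
have /zmax : above z' by split=> //; apply: weakly_dominates_trans zy.
apply/negP; rewrite -ltNge (bigD1 k) //= [ltRHS](bigD1 k) //=.
by apply: ltr_leD => //; apply: ler_sum => i _; apply: z'z.
Qed.

End WeakDominance.

(** * Weights, layers and finiteness of paths *)

Section Paths.
Variables (R : realType) (K : nat) (X A : choiceType).
Variables (N : network R K X A) (mN : network_model N).

Lemma path_weight_cat p q :
  path_weight N (p ++ q) = path_weight N p + path_weight N q.
Proof. exact: big_cat. Qed.

Lemma is_path_arc_layer x p y a : is_path N x p y -> a \in p ->
  (layer N x <= layer N (src N a) < layer N y)%N.
Proof.
elim: p x => //= b p IH x [Ab <- Hp]; rewrite inE => /orP[/eqP ->|].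
  by rewrite leqnn (is_path_layer mN Hp) (arc_layer mN Ab) leq_addr.
by move=> /(IH _ Hp); rewrite (arc_layer mN Ab) => /andP[/ltnW -> ->].
Qed.

Lemma is_path_remove_arc a x p y :
  is_path (remove_arc N a) x p y <-> is_path N x p y /\ a \notin p.
Proof.
elim: p x => [|b p IH] x /=; first by split=> [|[]].
rewrite inE negb_or eq_sym; split.
  by case=> -[Ab /eqP ba] sb /IH[Hp ap]; split=> //; apply/andP.
by case=> -[Ab sb Hp] /andP[/eqP ba ap]; split=> //; apply/IH.
Qed.

(** Each arc climbs exactly one layer, so all paths from [x] to [y] have the same length. *)
Lemma finite_path_weights x y :
  finite_set [set path_weight N p | p in [set p | is_path N x p y]].
Proof.
apply: finite_image.
apply: sub_finite_set (finite_set_seqs (layer N y - layer N x) (finite_arcs mN)).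
move=> p Hp; split; first by rewrite (is_path_layer mN Hp) addKn.
by move=> a /(is_path_arc Hp)[].
Qed.

End Paths.

(** * Paths in and through the subnetwork *)

Section Subnetwork.
Variables (R : realType) (K : nat) (X A : choiceType).
Variables (N : network R K X A) (mN : network_model N) (u v : X).
Let M := subnetwork N u v.

Lemma subnetwork_src a : arcs M a -> nodes M (src N a).
Proof. by case=> p Hp ap; exists p => //; have [] := is_path_arc Hp ap. Qed.

Lemma subnetwork_tgt a : arcs M a -> nodes M (tgt N a).
Proof. by case=> p Hp ap; exists p => //; rewrite inE map_f ?orbT. Qed.

Lemma subnetwork_node_paths x : nodes M x ->
  exists p q, is_path N u p x /\ is_path N x q v.
Proof.
by case=> p Hp /(is_path_split mN Hp)[p1 [p2 [_ H1 H2]]]; exists p1, p2.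
Qed.

Lemma is_path_subnetwork p : is_path M u p v <-> is_path N u p v.
Proof.
split.
  (* Only the start of the path varies; the [u] inside [M] stays fixed. *)
  elim: p {1 2}u => [|a p IH] x /= [].
    by case=> q Hq _ ->; have [_ ? _] := is_path_nodes mN Hq.
  by move=> [q Hq aq] sa /IH Hp; have [Aa _] := is_path_arc Hq aq; split.
(* The whole path witnesses that its arcs are in [M]. This is recorded before the induction, whose
   tails no longer start at [u]. *)
move=> Hp; have pM : {in p, forall a, arcs M a} by move=> a ap; exists p.
have vM : nodes M v by exists p => //; apply: is_path_last Hp.
move: Hp; elim: p {1 2}u pM => [|a p IH] x pM /= [].
  by move=> _ ->.
move=> Aa sa Hp; split=> //; first by apply: pM; rewrite mem_head.
by apply: IH => // b bp; apply: pM; rewrite inE bp orbT.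
Qed.

(** No node lies below layer 1, so a path from [u] to the root is empty. *)
Lemma root_subnetwork : nodes M (Defs.root N) -> Defs.root N = u.
Proof.
case/subnetwork_node_paths=> p [_ [Hp _]].
have [Nu _ _] := is_path_nodes mN Hp.
have [_ lr] : [set x | nodes N x /\ layer N x = 1%N] (Defs.root N).
  by rewrite (first_layer mN).
have := is_path_layer mN Hp; rewrite lr.
have /andP[+ _] := layer_range mN Nu.
case: (layer N u) => // k _ /eqP; rewrite addSn eqSS eq_sym addn_eq0.
by case/andP=> _ /eqP/size0nil p0; move: Hp; rewrite p0 => -[].
Qed.

Lemma terminal_subnetwork : nodes M (terminal N) -> terminal N = v.
Proof.
case/subnetwork_node_paths=> _ [p [_ Hp]].
have [_ Nv _] := is_path_nodes mN Hp.
have [_ lt] : [set x | nodes N x /\ layer N x = (depth N).+1] (terminal N).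
  by rewrite (last_layer mN).
have /andP[_] := layer_range mN Nv.
rewrite (is_path_layer mN Hp) lt -[leqRHS]addn0 leq_add2l leqn0.
by move=> /eqP/size0nil p0; move: Hp; rewrite p0 => -[].
Qed.

Hypothesis uv_isolating : isolating N u v.

(** Going backwards from [y], an arc whose target is in [M] either belongs to [M], and so does its
    source, or has target [u] by isolation. *)
Lemma isolating_enter x p y : is_path N x p y -> nodes M y ->
  nodes M x \/ u \in path_nodes N x p.
Proof.
move=> + My; elim: p x => [|a p IH] x /=; first by case=> _ ->; left.
case=> Aa sa /IH[Mt|up]; last by right; rewrite inE up orbT.
have [Ma|nMa] := pselect (arcs M a).
  by left; rewrite -sa; apply: subnetwork_src.
by right; have [/(_ Mt) tu _] := uv_isolating Aa nMa; rewrite !inE tu eqxx orbT.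
Qed.

(** Mirror image of [isolating_enter]: an arc that starts in [M] either stays in [M] or starts at
    [v]. *)
Lemma isolating_leave x p y : is_path N x p y -> nodes M x ->
  nodes M y \/ v \in path_nodes N x p.
Proof.
elim: p x => [|a p IH] x /=; first by case=> _ -> ?; left.
case=> Aa sa Hp Mx; have [Ma|nMa] := pselect (arcs M a).
  have [|vp] := IH _ Hp (subnetwork_tgt Ma); first by left.
  by right; rewrite inE vp orbT.
by right; have [_] := uv_isolating Aa nMa; rewrite sa => ->; rewrite ?mem_head.
Qed.

(** Cut at the source of [a], a node of [M]: the first half meets [u] and the second meets [v]. *)
Lemma isolating_path_split a p : arcs M a ->
  is_path N (Defs.root N) p (terminal N) -> a \in p ->
  exists q1 q q2, [/\ p = q1 ++ q ++ q2, is_path N (Defs.root N) q1 u,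
    is_path N u q v & is_path N v q2 (terminal N)].
Proof.
move=> Ma Hp ap; have [_ sa] := is_path_arc Hp ap.
have [p1 [p2 [-> H1 H2]]] := is_path_split mN Hp sa.
have Ms := subnetwork_src Ma.
have up1 : u \in path_nodes N (Defs.root N) p1.
  (* If the root is itself in [M], it equals [u], which then starts the half. *)
  have [/root_subnetwork <-|//] := isolating_enter H1 Ms.
  by rewrite mem_head.
have vp2 : v \in path_nodes N (src N a) p2.
  have [/terminal_subnetwork <-|//] := isolating_leave H2 Ms.
  exact: is_path_last H2.
have [q1 [q3 [-> Hq1 Hq3]]] := is_path_split mN H1 up1.
have [q4 [q2 [-> Hq4 Hq2]]] := is_path_split mN H2 vp2.
exists q1, (q3 ++ q4), q2; split=> //; first by rewrite !catA.
by apply/(is_path_cat _ _ _ _ mN); exists (src N a).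
Qed.

End Subnetwork.

Theorem theorem3 (R : realType) (K : nat) (X A : choiceType)
    (N : network R K X A) (u v : X)
    (N_model : network_model N)
    (u_node : nodes N u) (v_node : nodes N v)
    (layer_uv : (layer N u < layer N v)%N)
    (uv_isolating : isolating N u v)
    (a : A) (a_arc : arcs (subnetwork N u v) a) :
  PF (subnetwork N u v) = PF (remove_arc (subnetwork N u v) a) ->
  PF N = PF (remove_arc N a).
Proof.
move=> PFM; apply: ND_cofinal_subset.
  by move=> _ [p /is_path_remove_arc[Hp _] <-]; exists p.
move=> _ [p Hp <-].
have [ap|ap] := boolP (a \in p); last first.
  by exists (path_weight N p) => //; exists p => //; apply/is_path_remove_arc.
have [q1 [q [q2 [-> Hq1 Hq Hq2]]]] :=
  isolating_path_split N_model uv_isolating a_arc Hp ap.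
(* The segment [q] shows that [u] and [v] are joined, as a model requires. *)
have M_model : network_model (subnetwork N u v).
  by apply: subnetwork_model => //; exists q.
have [w PFw wq] : exists2 w, PF (subnetwork N u v) w &
    weakly_dominates w (path_weight N q).
  apply: finite_ND_cofinal; first exact: (finite_path_weights M_model).
  by exists q => //; apply/is_path_subnetwork.
move: PFw; rewrite PFM => -[[q' /is_path_remove_arc[Hq' aq'] Ew] _].
have {}Ew : path_weight N q' = w := Ew.
move/(is_path_subnetwork N_model): Hq' => Hq'.
(* Since [a] lies on a path [r] from [u] to [v], its source has a layer at least that of [u] and
   below that of [v]. *)
have [r Hr ar] := a_arc.
have /andP[lu lv] := is_path_arc_layer N_model Hr ar.
exists (path_weight N (q1 ++ q' ++ q2)); last first.
  move=> k; rewrite !path_weight_cat !mxE lerD2l lerD2r Ew; exact: wq.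
exists (q1 ++ q' ++ q2) => //; apply/is_path_remove_arc; split.
  apply/(is_path_cat _ _ _ _ N_model); exists u => //.
  by apply/(is_path_cat _ _ _ _ N_model); exists v.
(* Arcs of [q1] start strictly below the layer of [u], those of [q2] at or above that of [v], so
   neither piece contains [a]. *)
rewrite !mem_cat (negbTE aq') /= negb_or; apply/andP; split.
  apply/negP => /(is_path_arc_layer N_model Hq1)/andP[_].
  by rewrite ltnNge lu.
apply/negP => /(is_path_arc_layer N_model Hq2)/andP[+ _].
by rewrite leqNgt lv.
Qed.
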